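(* Let $\bar b\in\mathbb{Q}^2$ and the rational symmetric positive definite matrices $Q_1,Q_2$ be the specific data defined in the context, and consider $$\min_{x,y,z\in\mathbb{R}^2}\ \tfrac12x^\top Q_1x+\tfrac12y^\top Q_2y+\iota_{\mathbb{R}_+^2}(z)\quad\text{s.t.}\quad x+y+z=\bar b .$$ There is a rational initialization $(x^0,y^0,z^0,\lambda^0)\in\mathbb{Q}^8$ for which the sequence $(x^k,y^k,z^k,\lambda^k)_{k\ge0}$ generated by the unmodified direct three-block ADMM with $\beta=1$ (described in the context) is bounded, non-KKT (no element of the sequence is a KKT point of the problem), and periodic with minimal period $66$. With $q^k:=z^k+\lambda^k$ (for $k\ge1$ this is the projection input of step $k$), its strict projection-sign sequence over one period $k=0,1,\dots,65$ is $$\mathcal W=(00)^2(01)^{64},$$ that is, $q_1^k<0$ for $0\le k<66$, $q_2^k<0$ for $k=0,1$, and $q_2^k>0$ for $2\le k<66$. All $132$ projection inequalities are strict with a common margin greater than $10^{-3}$: $\min_{0\le k<66}\min_{i\in\{1,2\}}|q_i^k|>10^{-3}$. Consequently, having the identity matrix as third constraint block does not guarantee unconditional global convergence of direct three-block ADMM.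
   Context: Data. Set $$\varepsilon=\tfrac1{1000},\quad \mu=\tfrac{8957}{10000},\quad \nu=\tfrac{999}{1000},\quad d_1=(-1,20)^\top,\quad d_2=(-1,10)^\top,$$ $$M=\varepsilon I_2+(\mu-\varepsilon)\frac{d_1d_1^\top}{d_1^\top d_1},\quad Q_1=M^{-1}-I_2,\qquad N=\varepsilon I_2+(\nu-\varepsilon)\frac{d_2d_2^\top}{d_2^\top d_2},\quad Q_2=N^{-1}-I_2,$$ $$z^\star=(0,1)^\top,\quad \lambda^\star=(-1,0)^\top,\quad x^\star=Q_1^{-1}\lambda^\star,\quad y^\star=Q_2^{-1}\lambda^\star,\quad \bar b=x^\star+y^\star+z^\star .$$ Notation. $\iota_C$ is the indicator function of $C$ ($0$ on $C$, $+\infty$ off $C$); $[a]_+$ is the componentwise positive part $\max\{a_i,0\}$. Direct three-block ADMM (order $x\to y\to z\to\lambda$, $\beta=1$) for this problem is, from $(x^k,y^k,z^k,\lambda^k)$, $$x^{k+1}=M(\bar b-y^k-z^k+\lambda^k),\qquad y^{k+1}=N(\bar b-x^{k+1}-z^k+\lambda^k),$$ $$z^{k+1}=[\bar b-x^{k+1}-y^{k+1}+\lambda^k]_+,\qquad \lambda^{k+1}=\lambda^k-(x^{k+1}+y^{k+1}+z^{k+1}-\bar b).$$ These are the exact successive minimizations over $x$, $y$, $z$ of the augmented Lagrangian $\tfrac12x^\top Q_1x+\tfrac12y^\top Q_2y+\iota_{\mathbb{R}_+^2}(z)-\lambda^\top r+\tfrac12\|r\|^2$, $r=x+y+z-\bar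 b$, followed by the multiplier step. The projection input of step $k+1$ is $q^{k+1}=\bar b-x^{k+1}-y^{k+1}+\lambda^k$, which equals $z^{k+1}+\lambda^{k+1}$. In a projection-sign symbol, the $i$-th bit is $1$ if the $i$-th component of the projection input is positive and $0$ if it is negative; exponents denote consecutive repetition. A KKT point is $(x,y,z,\lambda)$ with $Q_1x=\lambda$, $Q_2y=\lambda$, $x+y+z=\bar b$, $z\in\mathbb{R}_+^2$, $\lambda\in N_{\mathbb{R}_+^2}(z)$ (normal cone; i.e. $z\ge0$, $\lambda\le0$, $\lambda^\top z=0$). *)

(* Defs.v *)
From mathcomp Require Import all_boot all_order all_algebra.
From mathcomp Require Import all_classical all_reals all_analysis.

Set Implicit Arguments.
Unset Strict Implicit.
Unset Printing Implicit Defensive.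

Import Order.TTheory GRing.Theory Num.Theory.
Import numFieldNormedType.Exports.

Local Open Scope classical_set_scope.
Local Open Scope ring_scope.

Section ConvexAnalysis.
Context {R : realType}.

Definition dot {n} (u v : 'cV[R]_n) : R := (u^T *m v) 0 0.

Definition sym_posdef {n} (A : 'M[R]_n) : Prop :=
  A^T = A /\ forall v : 'cV[R]_n, v != 0 -> 0 < dot v (A *m v).

Definition indicator {n} (C : set 'cV[R]_n) (z : 'cV[R]_n) : \bar R :=
  if z \in C then 0%E else +oo%E.

Definition nonneg_orthant {n} : set 'cV[R]_n := [set z | forall i, 0 <= z i 0].

Definition normal_cone {n} (C : set 'cV[R]_n) (z : 'cV[R]_n) : set 'cV[R]_n :=
  [set l | C z /\ forall w, C w -> dot l (w - z) <= 0].

Definition pos_part {n} (a : 'cV[R]_n) : 'cV[R]_n :=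
  map_mx (fun t => Num.max t 0) a.

Definition convex_ereal {n} (f : 'cV[R]_n -> \bar R) : Prop :=
  forall (x y : 'cV[R]_n) (t : R), 0 <= t <= 1 ->
    (f (t *: x + (1 - t) *: y)%R <= t%:E * f x + (1 - t)%:E * f y)%E.

Definition closed_proper_convex {n} (f : 'cV[R]_n -> \bar R) : Prop :=
  [/\ lower_semicontinuous f,
      forall x, (-oo < f x)%E,
      exists x, (f x < +oo)%E
    & convex_ereal f].

Definition subdifferential {n} (f : 'cV[R]_n -> \bar R) (x : 'cV[R]_n) :
    set 'cV[R]_n :=
  [set g | f x \is a fin_num /\
           forall s, (f x + (dot g (s - x)%R)%:E <= f s)%E].

Definition is_argmin {n} (f : 'cV[R]_n -> \bar R) (x : 'cV[R]_n) : Prop :=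
  forall s, (f x <= f s)%E.

End ConvexAnalysis.

(* min theta1 x + theta2 y + theta3 z  s.t.  A1 x + A2 y + A3 z = b *)
Record three_block_problem (R : realType) (m n1 n2 n3 : nat) := ThreeBlock {
  theta1 : 'cV[R]_n1 -> \bar R;
  theta2 : 'cV[R]_n2 -> \bar R;
  theta3 : 'cV[R]_n3 -> \bar R;
  block1 : 'M[R]_(m, n1);
  block2 : 'M[R]_(m, n2);
  block3 : 'M[R]_(m, n3);
  rhs : 'cV[R]_m }.

(* A point (x, y, z, lambda). *)
Definition primal_dual (R : realType) (m n1 n2 n3 : nat) : Type :=
  ('cV[R]_n1 * 'cV[R]_n2 * 'cV[R]_n3 * 'cV[R]_m)%type.

Section DirectADMM.
Context {R : realType} {m n1 n2 n3 : nat}.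
Variable P : three_block_problem R m n1 n2 n3.

Definition residual x y z : 'cV[R]_m :=
  block1 P *m x + block2 P *m y + block3 P *m z - rhs P.

(* The augmented Lagrangian is theta1 x + theta2 y + theta3 z + coupling.  In
   each block minimization the thetas of the two frozen blocks are constants
   and are left out: when the frozen z is infeasible, keeping theta3 z = +oo
   would make every point a minimizer. *)
Definition coupling (beta : R) (l : 'cV[R]_m) x y z : R :=
  - dot l (residual x y z)
  + beta / 2 * dot (residual x y z) (residual x y z).

Definition direct_admm_next (beta : R) (w w' : primal_dual R m n1 n2 n3) : Prop :=
  let: (x, y, z, l) := w in
  let: (x', y', z', l') := w' in
  [/\ is_argmin (fun s => theta1 P s + (coupling beta l s y z)%:E)%E x',
      is_argmin (fun s => theta2 P s + (coupling beta l x' s z)%:E)%E y',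
      is_argmin (fun s => theta3 P s + (coupling beta l x' y' s)%:E)%E z'
    & l' = l - beta *: residual x' y' z'].

Definition direct_admm_sequence (beta : R)
    (u : nat -> primal_dual R m n1 n2 n3) : Prop :=
  forall k, direct_admm_next beta (u k) (u k.+1).

Definition is_KKT (w : primal_dual R m n1 n2 n3) : Prop :=
  let: (x, y, z, l) := w in
  [/\ subdifferential (theta1 P) x ((block1 P)^T *m l),
      subdifferential (theta2 P) y ((block2 P)^T *m l),
      subdifferential (theta3 P) z ((block3 P)^T *m l)
    & residual x y z = 0].

End DirectADMM.

(* Full column rank of the first two blocks makes every subproblem uniquely
   solvable, so that this cannot fail merely because a subproblem has several
   minimizers. *)
Definition identity_block_ensures_global_convergence (R : realType) : Prop :=
  forall (m n1 n2 : nat) (P : three_block_problem R m n1 n2 m),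
    closed_proper_convex (theta1 P) ->
    closed_proper_convex (theta2 P) ->
    closed_proper_convex (theta3 P) ->
    \rank (block1 P) = n1 ->
    \rank (block2 P) = n2 ->
    block3 P = 1%:M ->
    (exists w, is_KKT P w) ->
  forall (beta : R) (u : nat -> primal_dual R m n1 n2 m),
    0 < beta -> direct_admm_sequence P beta u ->
    exists2 w, is_KKT P w & u @ \oo --> w.

Definition vec2 {F : Type} (a b : F) : 'cV[F]_2 :=
  \col_(i < 2) if i == 0 then a else b.

Definition eps : rat := 1 / 1000.
Definition mu : rat := 8957 / 10000.
Definition nu : rat := 999 / 1000.
Definition d1 : 'cV[rat]_2 := vec2 (-1) 20.
Definition d2 : 'cV[rat]_2 := vec2 (-1) 10.

Definition M : 'M[rat]_2 :=
  eps *: 1%:M + ((mu - eps) / (d1^T *m d1) 0 0) *: (d1 *m d1^T).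
Definition N : 'M[rat]_2 :=
  eps *: 1%:M + ((nu - eps) / (d2^T *m d2) 0 0) *: (d2 *m d2^T).
Definition Q1 : 'M[rat]_2 := invmx M - 1%:M.
Definition Q2 : 'M[rat]_2 := invmx N - 1%:M.

Definition z_star : 'cV[rat]_2 := vec2 0 1.
Definition lambda_star : 'cV[rat]_2 := vec2 (-1) 0.
Definition x_star : 'cV[rat]_2 := invmx Q1 *m lambda_star.
Definition y_star : 'cV[rat]_2 := invmx Q2 *m lambda_star.
Definition bbar : 'cV[rat]_2 := x_star + y_star + z_star.

Section Example.
Variable R : realType.

Definition to_real {m n} (A : 'M[rat]_(m, n)) : 'M[R]_(m, n) := map_mx ratr A.

Local Notation state := (primal_dual R 2 2 2 2).

Definition qp_problem : three_block_problem R 2 2 2 2 := {|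
  theta1 := fun x => (2^-1 * dot x (to_real Q1 *m x))%:E;
  theta2 := fun y => (2^-1 * dot y (to_real Q2 *m y))%:E;
  theta3 := indicator nonneg_orthant;
  block1 := 1%:M;
  block2 := 1%:M;
  block3 := 1%:M;
  rhs := to_real bbar |}.

(* The exact subproblem solutions of direct ADMM on qp_problem, beta = 1. *)
Definition qp_admm_step (w : state) : state :=
  let: (x, y, z, l) := w in
  let b := to_real bbar in
  let x' := to_real M *m (b - y - z + l) in
  let y' := to_real N *m (b - x' - z + l) in
  let z' := pos_part (b - x' - y' + l) in
  let l' := l - (x' + y' + z' - b) in
  (x', y', z', l').

Definition qp_admm (w0 : state) (k : nat) : state := iter k qp_admm_step w0.

Definition qp_KKT (w : state) : Prop :=
  let: (x, y, z, l) := w in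
  [/\ to_real Q1 *m x = l,
      to_real Q2 *m y = l,
      x + y + z = to_real bbar,
      nonneg_orthant z
    & normal_cone nonneg_orthant z l].

(* For k >= 1 this is the argument of pos_part in step k. *)
Definition proj_input (w : state) : 'cV[R]_2 :=
  let: (_, _, z, l) := w in z + l.

End Example.

Definition minimal_period {T : Type} (p : nat) (u : nat -> T) : Prop :=
  [/\ (0 < p)%N,
      forall k, u (k + p)%N = u k
    & forall j, (0 < j < p)%N -> ~ forall k, u (k + j)%N = u k].

(* (00)^2 (01)^64 *)
Definition word : seq (bool * bool) :=
  nseq 2 (false, false) ++ nseq 64 (false, true).

Definition strict_sign {R : realType} (s : bool) (a : R) : bool :=
  if s then 0 < a else a < 0.

Definition has_sign_symbol {R : realType} (s : bool * bool) (q : 'cV[R]_2) : Prop :=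
  strict_sign s.1 (q 0 0) /\ strict_sign s.2 (q 1 0).

(* Main.v *)
From Stdlib Require Import BinInt.
Require Import Defs.
From mathcomp Require Import all_boot all_order all_algebra.
From mathcomp Require Import all_classical all_reals all_analysis.
From mathcomp Require Import ssrZ zify ring lra.
Import Order.TTheory GRing.Theory Num.Theory.
Import numFieldNormedType.Exports.
Local Open Scope classical_set_scope.
Local Open Scope ring_scope.

(** One step of the method is piecewise affine.  The block x is recomputed from
    (y, z, lambda), and (z, lambda) is the positive and the negative part of the
    projection input q = z + lambda, so the state is the pair (y, q) in
    dimension 4, and the step is affine on each sign quadrant of q.  Along a
    prescribed itinerary of 66 quadrants the return map is therefore affine with
    rational coefficients.  For the word (00)^2 (01)^64 it has exactly one fixed
    point, which is rational; if the orbit of that point really visits the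
    prescribed quadrants, it is a periodic orbit of the method.

    The fixed point is written down exactly, with numerators over a common
    denominator of 1135 digits, and its itinerary is verified in integer
    arithmetic.  The state is measured from the KKT point
    (x_star, y_star, z_star, lambda_star), which removes bbar from the
    recurrence.  The matrices M and N scale a line and its orthogonal
    complement by two numbers, so that 401 * 10000 M and 101 * 1000 N have small
    integer coefficients.  [scaled_step] is the step with all denominators
    cleared, [rat_step_yzl_of] compares it with the rational step, and
    [start_itinerary] is the computation: at each of the 66 times both
    coordinates of q have the required sign and exceed 1/1000 in absolute value,
    and after 66 steps the state is the initial one up to a common factor.

    The closed formulas for the step are the exact block minimizations: M and N
    are the resolvents (I + Q1)^-1 and (I + Q2)^-1, and the positive part is the
    projection onto the orthant ([qp_admm_nextP]).

    The remaining claims follow from periodicity and from the signs of the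
    second coordinate of q, which is negative exactly at times 0 and 1 modulo
    66.  A KKT point is fixed by the step ([qp_KKT_fixed]), so it would make the
    orbit constant.  A shift j < 66 that preserves the orbit preserves these
    signs, which forces j = 0.  A convergent periodic sequence is constant
    ([periodic_cvg]).  As the problem is convex, has a KKT point
    ([star_is_KKT]) and has identity blocks, the method does not converge
    globally in this class. *)

(** * Inner products and convex quadratics *)

Section DotProduct.
Context {R : realType} {n : nat}.
Implicit Types u v w : 'cV[R]_n.

Lemma dotE u v : dot u v = \sum_i u i 0 * v i 0.
Proof. by rewrite /dot mxE; apply: eq_bigr => i _; rewrite mxE. Qed.

Lemma dotC u v : dot u v = dot v u.
Proof. by rewrite !dotE; apply: eq_bigr => i _; rewrite mulrC. Qed.

Lemma dotDr u v w : dot u (v + w) = dot u v + dot u w.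
Proof. by rewrite /dot mulmxDr mxE. Qed.

Lemma dotZr a u v : dot u (a *: v) = a * dot u v.
Proof. by rewrite /dot -scalemxAr mxE. Qed.

Lemma dotNr u v : dot u (- v) = - dot u v.
Proof. by rewrite -scaleN1r dotZr mulN1r. Qed.

Lemma dotDl u v w : dot (u + v) w = dot u w + dot v w.
Proof. by rewrite !(dotC _ w) dotDr. Qed.

Lemma dotZl a u v : dot (a *: u) v = a * dot u v.
Proof. by rewrite !(dotC _ v) dotZr. Qed.

Lemma dotNl u v : dot (- u) v = - dot u v.
Proof. by rewrite !(dotC _ v) dotNr. Qed.

Lemma dot_ge0 v : 0 <= dot v v.
Proof. by rewrite dotE sumr_ge0 // => i _; rewrite -expr2 sqr_ge0. Qed.

Lemma dot_mulmx (A : 'M[R]_n) u v : A^T = A -> dot u (A *m v) = dot (A *m u) v.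
Proof. by move=> sA; rewrite /dot trmx_mul sA mulmxA. Qed.

End DotProduct.

Section Quadratic.
Context {R : realType} {n : nat} (Q : 'M[R]_n).
Hypothesis Qpd : sym_posdef Q.
Implicit Types x y d g : 'cV[R]_n.

Definition quad x : R := 2^-1 * dot x (Q *m x).

Lemma quad_ge0 x : 0 <= quad x.
Proof.
rewrite mulr_ge0 // ?invr_ge0 //; case: Qpd => _ pd.
have [->|/pd/ltW//] := eqVneq x 0.
by rewrite mulmx0 dot_ge0.
Qed.

Lemma quadD x d : quad (x + d) = quad x + dot (Q *m x) d + quad d.
Proof.
have [sQ _] := Qpd.
rewrite /quad mulmxDr !dotDr !dotDl (dot_mulmx _ x d) // (dotC d (Q *m x)).
by field.
Qed.

Lemma quadZ a x : quad (a *: x) = a ^+ 2 * quad x.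
Proof. by rewrite /quad -scalemxAr dotZr dotZl; ring. Qed.

(** The gap in the gradient inequality is the quadratic form of the
    displacement. *)
Lemma quad_subgradient x g :
  Q *m x = g -> subdifferential (fun s => (quad s)%:E) x g.
Proof.
move=> Qxg; split=> // s; rewrite -EFinD lee_fin.
by rewrite -[in leRHS](subrK x s) addrC [s - x + x]addrC quadD Qxg addrC lerDl quad_ge0.
Qed.

Lemma quad_continuous : continuous quad.
Proof.
have -> : quad = fun x => 2^-1 * \sum_i x i 0 * \sum_j Q i j * x j 0.
  apply/funext => x; rewrite /quad dotE; congr (_ * _).
  by apply: eq_bigr => i _; rewrite mxE.
have sum_cont (F : 'I_n -> 'cV[R]_n -> R) :
    (forall i, continuous (F i)) -> continuous (fun x => \sum_i F i x).
  by move=> Fc; apply: continuous_big => //; exact: add_continuous.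
have mul_cont (f g : 'cV[R]_n -> R) :
    continuous f -> continuous g -> continuous (fun x => f x * g x).
  by move=> fc gc x; exact: (continuousM (fc x) (gc x)).
apply/mul_cont; first exact: cst_continuous.
apply/sum_cont => i; apply/mul_cont; first exact: coord_continuous.
apply/sum_cont => j; apply/mul_cont; first exact: cst_continuous.
exact: coord_continuous.
Qed.

(** Convexity holds because the Jensen gap at t is t (1 - t) times the quadratic
    form of x - y. *)
Lemma quad_closed_proper_convex : closed_proper_convex (fun x => (quad x)%:E).
Proof.
split.
- move=> x a; rewrite lte_fin => ax.
  exists (quad @^-1` [set t | a < t]) => //.
  exact: (quad_continuous x _ (lt_nbhsr ax)).
- by move=> x; rewrite ltNyr.
- by exists 0; rewrite ltry.
- move=> x y t /andP[t0 t1]; rewrite -!EFinM -EFinD lee_fin.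
  have -> : t *: x + (1 - t) *: y = y + t *: (x - y).
    by apply/matrixP => i j; rewrite !mxE; ring.
  have -> : quad x = quad y + dot (Q *m y) (x - y) + quad (x - y).
    by rewrite -quadD addrC subrK.
  rewrite quadD quadZ dotZr -subr_ge0.
  set a := quad y; set b := dot _ _; set c := quad (x - y).
  have -> : t * (a + b + c) + (1 - t) * a - (a + t * b + t ^+ 2 * c)
     = t * (1 - t) * c by ring.
  by apply: mulr_ge0; [rewrite mulr_ge0 ?subr_ge0|exact: quad_ge0].
Qed.

End Quadratic.

(** * The nonnegative orthant *)

Section Orthant.
Context {R : realType} {n : nat}.
Implicit Types z l v : 'cV[R]_n.

(** The optimality conditions of the orthant, coordinate by coordinate: l is in
    the normal cone at z exactly when they hold. *)
Definition complementary z l : Prop :=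
  forall i, [/\ 0 <= z i 0, l i 0 <= 0 & l i 0 * z i 0 = 0].

Lemma indicator_in z : nonneg_orthant z -> indicator nonneg_orthant z = 0%E :> \bar R.
Proof. by move=> /mem_set zC; rewrite /indicator zC. Qed.

Lemma indicator_notin z : ~ nonneg_orthant z -> indicator nonneg_orthant z = +oo%E :> \bar R.
Proof. by move=> zC; rewrite /indicator memNset. Qed.

Lemma complementary_dot_le0 z l w :
  complementary z l -> nonneg_orthant w -> dot l (w - z) <= 0.
Proof.
move=> zl w0; rewrite dotE sumr_le0 // => i _.
have [_ l0 lz] := zl i; rewrite !mxE mulrBr lz subr0.
by rewrite mulr_le0_ge0.
Qed.

Lemma indicator_subgradient z l :
  complementary z l -> subdifferential (indicator nonneg_orthant) z l.
Proof.
move=> zl; have z0 : nonneg_orthant z by move=> i; case: (zl i).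
split; first by rewrite indicator_in.
move=> s; rewrite indicator_in // add0e.
have [s0|s0] := pselect (nonneg_orthant s); last by rewrite indicator_notin // leey.
by rewrite indicator_in // lee_fin complementary_dot_le0.
Qed.

(** The defining inequality is tested at z + t e_i, with t = 1 for the sign of
    l_i and t = - z_i for complementarity. *)
Lemma normal_cone_complementary z l :
  normal_cone nonneg_orthant z l -> complementary z l.
Proof.
move=> [z0 lC] i.
have zi0 : 0 <= z i 0 by exact: z0.
have move_i t : 0 <= z i 0 + t -> l i 0 * t <= 0.
  move=> t0; have := lC (z + t *: delta_mx i 0).
  rewrite [z + _ - z]addrAC subrr add0r dotE (bigD1 i) //= big1 ?addr0; last first.
    by move=> j ji; rewrite !mxE (negPf ji) !mulr0.
  rewrite !mxE !eqxx !mulr1; apply=> j; rewrite !mxE eqxx andbT.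
  by have [->|_] := eqVneq j i; rewrite ?mulr1 // mulr0 addr0 z0.
have li0 : l i 0 <= 0 by rewrite -[leLHS]mulr1 move_i // addr_ge0.
split=> //; apply/eqP; rewrite eq_le mulr_le0_ge0 //=.
by rewrite -oppr_le0 -mulrN move_i // subrr.
Qed.

(** The Moreau decomposition of v: its projection onto the orthant and a normal
    vector there.  [complementary_pos_part] is the converse. *)
Lemma pos_part_complementary v : complementary (pos_part v) (v - pos_part v).
Proof.
move=> i; rewrite !mxE; case: (lerP 0 (v i 0)) => [vi|/ltW vi].
  by rewrite subrr mul0r; split.
by rewrite subr0 mulr0; split.
Qed.

Lemma complementary_pos_part z l : complementary z l -> pos_part (z + l) = z.
Proof.
move=> zl; apply/matrixP => i j; rewrite (ord1 j) !mxE.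
have [z0 l0 /eqP] := zl i; rewrite mulf_eq0 => /orP[]/eqP e; rewrite e.
  by rewrite addr0 max_l.
by rewrite add0r max_r.
Qed.

Lemma indicator_closed_proper_convex :
  closed_proper_convex (indicator (@nonneg_orthant R n)).
Proof.
have ind_ge0 z : (0 <= indicator (@nonneg_orthant R n) z)%E.
  by rewrite /indicator; case: ifP.
split.
- move=> z a; have [z0|z0] := pselect (nonneg_orthant z).
    rewrite indicator_in // lte_fin => a0; exists setT; first exact: filterT.
    by move=> y _; apply: lt_le_trans (ind_ge0 y).
  move=> _; have /existsNP[i /negP] := z0; rewrite -ltNge => zi.
  exists ((fun y : 'cV[R]_n => y i 0) @^-1` [set t | t < 0]).
    exact: (coord_continuous (lt_nbhsl zi)).
  move=> y /= yi; rewrite indicator_notin ?ltry // => /(_ i).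
  by rewrite leNgt yi.
- by move=> z; apply: lt_le_trans (ind_ge0 z).
- by exists 0; rewrite indicator_in ?ltry // => i; rewrite mxE.
- move=> x y t /andP[t0 t1].
  have [x0|x0] := pselect (nonneg_orthant x); last first.
    rewrite (indicator_notin x) //.
    move: t0; rewrite le_eqVlt => /orP[/eqP <-|t0].
      by rewrite mul0e scale0r add0r subr0 scale1r add0e mul1e.
    rewrite gt0_muley ?lte_fin // addye ?leey // gt_eqF //.
    by apply: lt_le_trans (mule_ge0 _ (ind_ge0 y)); rewrite ?lee_fin ?subr_ge0.
  have [y0|y0] := pselect (nonneg_orthant y); last first.
    rewrite (indicator_notin y) //.
    move: t1; rewrite le_eqVlt => /orP[/eqP ->|t1].
      by rewrite subrr mul0e scale0r addr0 scale1r adde0 mul1e.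
    rewrite [((1 - t)%:E * _)%E]gt0_muley ?lte_fin ?subr_gt0 //.
    rewrite addey ?leey // gt_eqF //.
    by apply: lt_le_trans (mule_ge0 _ (ind_ge0 x)); rewrite ?lee_fin.
  rewrite (indicator_in x) // (indicator_in y) // !mule0 adde0 indicator_in //.
  by move=> i; rewrite !mxE addr_ge0 // mulr_ge0 ?subr_ge0.
Qed.

End Orthant.

(** * Exact minimization over one block *)

Section AugmentedLagrangian.
Context {R : realType} {n : nat}.
Implicit Types l r c v : 'cV[R]_n.

(** The coupling term of the augmented Lagrangian at penalty parameter 1, as a
    function of the residual alone; one lemma then serves all three blocks. *)
Definition penalty l r : R := - dot l r + 1 / 2 * dot r r.

Lemma penaltyD l r c :
  penalty l (r + c) = penalty l r + dot (r - l) c + 2^-1 * dot c c.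
Proof. by rewrite /penalty !dotDr !dotDl (dotC c r) dotNl; field. Qed.

(** The hypothesis is stationarity.  Moving from x by d then raises the objective
    by quad Q d + |d|^2 / 2. *)
Lemma quad_block_argmin (Q : 'M[R]_n) l c x : sym_posdef Q ->
  Q *m x = l - (x + c) ->
  is_argmin (fun s => ((quad Q s)%:E + (penalty l (s + c))%:E)%E) x.
Proof.
move=> Qpd Qx s; rewrite -!EFinD lee_fin.
have -> : s = x + (s - x) by rewrite addrC subrK.
set d := s - x; rewrite addrAC (penaltyD l (x + c)) quadD // Qx -subr_ge0.
have -> : dot (x + c - l) d = - dot (l - (x + c)) d by rewrite -dotNl opprB.
have := quad_ge0 Q Qpd d; have := dot_ge0 d; lra.
Qed.

(** Here c - l is minus the projection input, so the first-order term at the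
    projection z is minus a normal vector applied to s - z. *)
Lemma orthant_block_argmin l c z : z = pos_part (l - c) ->
  is_argmin (fun s => (indicator nonneg_orthant s + (penalty l (s + c))%:E)%E) z.
Proof.
move=> zE s; have zv := pos_part_complementary (l - c); rewrite -zE in zv.
have z0 : nonneg_orthant z by move=> i; case: (zv i).
have [s0|s0] := pselect (nonneg_orthant s); last by rewrite (indicator_notin s) // addye ?leey.
rewrite !indicator_in // !add0e lee_fin.
have -> : s = z + (s - z) by rewrite addrC subrK.
have := complementary_dot_le0 _ _ _ zv s0; set d := s - z => vd.
rewrite addrAC (penaltyD l (z + c)) -subr_ge0.
have -> : dot (z + c - l) d = - dot (l - c - z) d.
  by rewrite -dotNl opprB opprB addrA.
have := dot_ge0 d; lra.
Qed.

End AugmentedLagrangian.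

(** * Matrices acting by two scalars *)

Section Spectral.
Context {F : fieldType} {n : nat}.
Implicit Types (d : 'cV[F]_n) (a b : F).

Definition line_proj d : 'M[F]_n := ((d^T *m d) 0 0)^-1 *: (d *m d^T).

(** Multiplication by b along d and by a on the orthogonal complement of d.
    Products, inverses and shifts of such matrices are computed on the two
    scalars. *)
Definition two_scale d a b : 'M[F]_n := a *: 1%:M + (b - a) *: line_proj d.

Lemma line_proj_idem d : (d^T *m d) 0 0 != 0 ->
  line_proj d *m line_proj d = line_proj d.
Proof.
move=> dd; rewrite /line_proj -scalemxAl -scalemxAr mulmxA -[d *m d^T *m d]mulmxA.
set k := (d^T *m d) 0 0; rewrite [d^T *m d]mx11_scalar -/k.
by rewrite mul_mx_scalar -scalemxAl !scalerA mulVf // mulr1.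
Qed.

Lemma two_scaleM d a b a' b' : (d^T *m d) 0 0 != 0 ->
  two_scale d a b *m two_scale d a' b' = two_scale d (a * a') (b * b').
Proof.
move=> /line_proj_idem; rewrite /two_scale; move: (line_proj d) => p pp.
rewrite mulmxDr !mulmxDl -!scalemxAr -!scalemxAl !mul1mx !mulmx1 pp.
by apply/matrixP => i j; rewrite !mxE; ring.
Qed.

Lemma two_scale1 d : two_scale d 1 1 = 1%:M.
Proof. by rewrite /two_scale subrr scale0r addr0 scale1r. Qed.

Lemma two_scale_sub1 d a b : two_scale d a b - 1%:M = two_scale d (a - 1) (b - 1).
Proof. by apply/matrixP => i j; rewrite !mxE; ring. Qed.

Lemma two_scaleMV d a b : (d^T *m d) 0 0 != 0 -> a != 0 -> b != 0 ->
  two_scale d a b *m two_scale d a^-1 b^-1 = 1%:M.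
Proof. by move=> dd a0 b0; rewrite two_scaleM // !mulfV // two_scale1. Qed.

Lemma two_scale_unit d a b : (d^T *m d) 0 0 != 0 -> a != 0 -> b != 0 ->
  two_scale d a b \in unitmx.
Proof. by move=> dd a0 b0; have [] := mulmx1_unit (two_scaleMV d a b dd a0 b0). Qed.

Lemma two_scaleV d a b : (d^T *m d) 0 0 != 0 -> a != 0 -> b != 0 ->
  invmx (two_scale d a b) = two_scale d a^-1 b^-1.
Proof.
move=> dd a0 b0; rewrite -[RHS](mulKmx (two_scale_unit d a b dd a0 b0)).
by rewrite two_scaleMV // mulmx1.
Qed.

Lemma two_scale_mulmx d a b (v : 'cV[F]_n) : two_scale d a b *m v =
  a *: v + ((b - a) * ((d^T *m d) 0 0)^-1 * (d^T *m v) 0 0) *: d.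
Proof.
rewrite mulmxDl -!scalemxAl mul1mx -mulmxA.
set k := (d^T *m v) 0 0; rewrite [d^T *m v]mx11_scalar -/k.
by rewrite mul_mx_scalar !scalerA.
Qed.

End Spectral.

Lemma to_real_two_scale (R : realType) n (d : 'cV[rat]_n) a b :
  to_real R (two_scale d a b) = two_scale (to_real R d) (ratr a) (ratr b).
Proof.
have projE : to_real R (line_proj d) = line_proj (to_real R d).
  have sqE : ((to_real R d)^T *m to_real R d) 0 0 = ratr ((d^T *m d) 0 0).
    by rewrite /to_real map_trmx -map_mxM mxE.
  by rewrite /line_proj sqE /to_real map_mxZ fmorphV map_mxM -map_trmx.
by rewrite /two_scale -projE /to_real map_mxD !map_mxZ map_mx1 rmorphB.
Qed.

(** The form is a |v - t d|^2 + b |t d|^2, where t d is the projection of v. *)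
Lemma two_scale_posdef (R : realType) n (d : 'cV[R]_n) a b :
  0 < dot d d -> 0 < a -> 0 < b -> sym_posdef (two_scale d a b).
Proof.
move=> dd a0 b0; split.
  have projT : (line_proj d)^T = line_proj d.
    by rewrite /line_proj linearZ /= trmx_mul trmxK.
  by rewrite /two_scale linearD; congr (_ + _); rewrite linearZ /= ?trmx1 ?projT.
move=> v v0; rewrite two_scale_mulmx dotDr !dotZr -!/(dot _ _) (dotC v d).
set t := dot d v / dot d d.
(* Pythagoras: v splits into its projection t d and the orthogonal rest *)
have vE : dot v v = dot (v - t *: d) (v - t *: d) + t ^+ 2 * dot d d.
  rewrite !dotDr !dotDl !dotNr !dotNl !dotZr !dotZl (dotC v d) /t.
  by field; rewrite gt_eqF.
have -> : a * dot v v + (b - a) / dot d d * dot d v * dot d v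
    = a * dot (v - t *: d) (v - t *: d) + b * (t ^+ 2 * dot d d).
  by rewrite vE /t; field; rewrite gt_eqF.
have rest0 := dot_ge0 (v - t *: d).
have [t0|t0] := eqVneq t 0; last first.
  by rewrite ltr_wpDl ?mulr_ge0 ?(ltW a0) // mulr_gt0 // mulr_gt0 // exprn_even_gt0.
rewrite t0 expr0n mul0r mulr0 addr0 scale0r subr0 mulr_gt0 // lt_neqAle dot_ge0 andbT.
apply: contra v0 => /eqP vv; apply/eqP/matrixP => i j; rewrite (ord1 j) mxE.
move/esym/eqP: vv; rewrite dotE psumr_eq0 => [/allP/(_ i)|k _]; last by rewrite -expr2 sqr_ge0.
by rewrite mem_index_enum => /(_ isT)/=; rewrite mulf_eq0 orbb => /eqP.
Qed.

(** * The quadratic program and its exact step *)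

Lemma d1_sq : (d1^T *m d1) 0 0 = 401.
Proof. by rewrite mxE !big_ord_recl big_ord0 !mxE /=. Qed.

Lemma d2_sq : (d2^T *m d2) 0 0 = 101.
Proof. by rewrite mxE !big_ord_recl big_ord0 !mxE /=. Qed.

Lemma eps_bounds : 0 < eps < 1. Proof. by rewrite /eps; lra. Qed.
Lemma mu_bounds : 0 < mu < 1. Proof. by rewrite /mu; lra. Qed.
Lemma nu_bounds : 0 < nu < 1. Proof. by rewrite /nu; lra. Qed.

Lemma d1_sq_neq0 : (d1^T *m d1) 0 0 != 0. Proof. by rewrite d1_sq pnatr_eq0. Qed.
Lemma d2_sq_neq0 : (d2^T *m d2) 0 0 != 0. Proof. by rewrite d2_sq pnatr_eq0. Qed.

(** M and N are given, and Q1 and Q2 are recovered from them; eigenvalues of the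
    resolvent in (0, 1) are what makes the recovered matrix positive definite. *)
Lemma resolvent_two_scale (F : realFieldType) n (d : 'cV[F]_n) a b :
  (d^T *m d) 0 0 != 0 -> 0 < a < 1 -> 0 < b < 1 ->
  [/\ two_scale d a b \in unitmx,
      invmx (two_scale d a b) - 1%:M = two_scale d (a^-1 - 1) (b^-1 - 1),
      0 < a^-1 - 1, 0 < b^-1 - 1
    & invmx (two_scale d a b) - 1%:M \in unitmx].
Proof.
move=> dd /andP[a0 a1] /andP[b0 b1].
have ia : 0 < a^-1 - 1 by rewrite subr_gt0 invf_gt1.
have ib : 0 < b^-1 - 1 by rewrite subr_gt0 invf_gt1.
have [a_neq0 b_neq0] := (lt0r_neq0 a0, lt0r_neq0 b0).
rewrite two_scaleV // two_scale_sub1.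
by split=> //; apply: two_scale_unit => //; exact: lt0r_neq0.
Qed.

Lemma ME : M = two_scale d1 eps mu.
Proof. by rewrite /M /two_scale; move: eps mu => a b; rewrite /line_proj scalerA. Qed.

Lemma NE : N = two_scale d2 eps nu.
Proof. by rewrite /N /two_scale; move: eps nu => a b; rewrite /line_proj scalerA. Qed.

Lemma M_resolvent : [/\ M \in unitmx, Q1 = two_scale d1 (eps^-1 - 1) (mu^-1 - 1),
  0 < eps^-1 - 1, 0 < mu^-1 - 1 & Q1 \in unitmx].
Proof. by rewrite /Q1 ME; exact: resolvent_two_scale d1_sq_neq0 eps_bounds mu_bounds. Qed.

Lemma N_resolvent : [/\ N \in unitmx, Q2 = two_scale d2 (eps^-1 - 1) (nu^-1 - 1),
  0 < eps^-1 - 1, 0 < nu^-1 - 1 & Q2 \in unitmx].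
Proof. by rewrite /Q2 NE; exact: resolvent_two_scale d2_sq_neq0 eps_bounds nu_bounds. Qed.

Lemma M_unit : M \in unitmx. Proof. by case: M_resolvent. Qed.
Lemma N_unit : N \in unitmx. Proof. by case: N_resolvent. Qed.
Lemma Q1_unit : Q1 \in unitmx. Proof. by case: M_resolvent. Qed.
Lemma Q2_unit : Q2 \in unitmx. Proof. by case: N_resolvent. Qed.

Section RealData.
Variable R : realType.

Lemma to_real_dot n (d : 'cV[rat]_n) :
  dot (to_real R d) (to_real R d) = ratr ((d^T *m d) 0 0).
Proof. by rewrite /dot /to_real map_trmx -map_mxM mxE. Qed.

Lemma Q1_posdef : sym_posdef (to_real R Q1).
Proof.
have dd : 0 < dot (to_real R d1) (to_real R d1) by rewrite to_real_dot d1_sq ltr0q ltr0n.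
have [_ -> a0 b0 _] := M_resolvent; rewrite to_real_two_scale.
by apply: (two_scale_posdef _ _ _ _ _ dd); rewrite ltr0q; [exact: a0|exact: b0].
Qed.

Lemma Q2_posdef : sym_posdef (to_real R Q2).
Proof.
have dd : 0 < dot (to_real R d2) (to_real R d2) by rewrite to_real_dot d2_sq ltr0q ltr0n.
have [_ -> a0 b0 _] := N_resolvent; rewrite to_real_two_scale.
by apply: (two_scale_posdef _ _ _ _ _ dd); rewrite ltr0q; [exact: a0|exact: b0].
Qed.

(** With Q = A^-1 - I, the matrix A is (I + Q)^-1: this is the stationarity of
    A v in the proximal problem with input v. *)
Lemma resolvent_eq n (A : 'M[rat]_n) (v : 'cV[R]_n) : A \in unitmx ->
  to_real R (invmx A - 1%:M) *m (to_real R A *m v) = v - to_real R A *m v.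
Proof.
move=> uA; rewrite mulmxA /to_real -map_mxM mulmxBl mulVmx // mul1mx.
by rewrite map_mxB map_mx1 mulmxBl mul1mx.
Qed.

(** The converse direction: a point with gradient Q x is the proximal point of
    x + Q x. *)
Lemma resolvent_fixed n (A : 'M[rat]_n) (x : 'cV[R]_n) : A \in unitmx ->
  to_real R A *m (x + to_real R (invmx A - 1%:M) *m x) = x.
Proof.
move=> uA; rewrite mulmxDr [to_real R A *m (_ *m _)]mulmxA /to_real -map_mxM.
by rewrite mulmxBr mulmxV // mulmx1 map_mxB map_mx1 mulmxBl mul1mx addrC subrK.
Qed.

Local Notation state := (primal_dual R 2 2 2 2).
Local Notation P := (qp_problem R).

Lemma qp_residualE x y z : residual P x y z = x + y + z - to_real R bbar.
Proof. by rewrite /residual /= !mul1mx. Qed.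

(** The new blocks are variables constrained by equations, so that no tactic has
    to decide whether two closed rational matrices coincide. *)
Lemma qp_admm_nextP b x y z l x' y' z' l' : b = to_real R bbar ->
  x' = to_real R M *m (b - y - z + l) ->
  y' = to_real R N *m (b - x' - z + l) ->
  z' = pos_part (b - x' - y' + l) ->
  l' = l - (x' + y' + z' - b) ->
  direct_admm_next P 1 (x, y, z, l) (x', y', z', l').
Proof.
move=> bE x'E y'E z'E l'E; split; last by rewrite qp_residualE scale1r -bE.
- have -> : (fun s => theta1 P s + (coupling P 1 l s y z)%:E)%E =
      (fun s => (quad (to_real R Q1) s)%:E + (penalty l (s + (y + z - b)))%:E)%E.
    by apply/funext => s; rewrite /coupling qp_residualE -bE /penalty !addrA.
  apply: quad_block_argmin; first exact: Q1_posdef.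
  have -> : to_real R Q1 *m x' = (b - y - z + l) - x'.
    by rewrite x'E /Q1; exact: resolvent_eq M_unit.
  by apply/matrixP => i j; rewrite !mxE; ring.
- have -> : (fun s => theta2 P s + (coupling P 1 l x' s z)%:E)%E =
      (fun s => (quad (to_real R Q2) s)%:E + (penalty l (s + (x' + z - b)))%:E)%E.
    apply/funext => s; rewrite /coupling qp_residualE -bE /penalty.
    by rewrite [x' + s]addrC !addrA.
  apply: quad_block_argmin; first exact: Q2_posdef.
  have -> : to_real R Q2 *m y' = (b - x' - z + l) - y'.
    by rewrite y'E /Q2; exact: resolvent_eq N_unit.
  by apply/matrixP => i j; rewrite !mxE; ring.
- have -> : (fun s => theta3 P s + (coupling P 1 l x' y' s)%:E)%E =
      (fun s => indicator nonneg_orthant s + (penalty l (s + (x' + y' - b)))%:E)%E.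
    apply/funext => s; rewrite /coupling qp_residualE -bE /penalty.
    by rewrite [x' + y' + s]addrC !addrA.
  apply: orthant_block_argmin; rewrite z'E; congr pos_part.
  by apply/matrixP => i j; rewrite !mxE; ring.
Qed.

Lemma qp_admm_step_next (w : state) : direct_admm_next P 1 w (qp_admm_step w).
Proof. by case: w => [[[x y] z] l]; exact: qp_admm_nextP (erefl _) _ _ _ _. Qed.

Lemma qp_admm_sequence (w : state) : direct_admm_sequence P 1 (qp_admm w).
Proof. by move=> k; rewrite /qp_admm iterS; exact: qp_admm_step_next. Qed.

Lemma qp_admm_stepP b x y z l x' y' z' l' : b = to_real R bbar ->
  x' = to_real R M *m (b - y - z + l) ->
  y' = to_real R N *m (b - x' - z + l) ->
  z' = pos_part (b - x' - y' + l) ->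
  l' = l - (x' + y' + z' - b) ->
  qp_admm_step (x, y, z, l) = (x', y', z', l').
Proof. by move=> -> -> -> -> ->. Qed.

(** At a KKT point the inputs of the three block updates are x + Q1 x, y + Q2 y
    and z + lambda, which the two resolvents and the projection send back to x, y
    and z. *)
Lemma qp_KKT_fixed (w : state) : qp_KKT w -> qp_admm_step w = w.
Proof.
case: w => [[[x y] z] l] [Qx Qy xyz _ /normal_cone_complementary zl].
apply: qp_admm_stepP xyz _ _ _ _.
- have -> : x + y + z - y - z + l = x + to_real R Q1 *m x.
    by rewrite Qx; apply/matrixP => i j; rewrite !mxE; ring.
  by symmetry; exact: resolvent_fixed M_unit.
- have -> : x + y + z - x - z + l = y + to_real R Q2 *m y.
    by rewrite Qy; apply/matrixP => i j; rewrite !mxE; ring.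
  by symmetry; exact: resolvent_fixed N_unit.
- have -> : x + y + z - x - y + l = z + l.
    by apply/matrixP => i j; rewrite !mxE; ring.
  by rewrite complementary_pos_part.
- by rewrite subrr subr0.
Qed.

Lemma star_is_KKT : is_KKT P
  (to_real R x_star, to_real R y_star, to_real R z_star, to_real R lambda_star).
Proof.
split; rewrite /= ?trmx1 ?mul1mx.
- apply: quad_subgradient; first exact: Q1_posdef.
  by rewrite /to_real -map_mxM /x_star mulKVmx ?Q1_unit.
- apply: quad_subgradient; first exact: Q2_posdef.
  by rewrite /to_real -map_mxM /y_star mulKVmx ?Q2_unit.
- apply: indicator_subgradient => i; rewrite !mxE.
  by case: ifP => _; rewrite ?rmorph0 ?rmorph1 ?rmorphN1 ?mulr0 ?mul0r;
     split; rewrite ?oppr_le0 ?ler01.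
- by rewrite qp_residualE /to_real /bbar !map_mxD subrr.
Qed.

End RealData.

(** * The step in integer arithmetic *)

(** The state with y - y_star = (eta1, eta2) / den and z + lambda =
    (q1, q2) / den.  Fractions are not reduced: every step multiplies den by the
    same constant. *)
Record scaled_state := ScaledState {
  den : Z; eta1 : Z; eta2 : Z; q1 : Z; q2 : Z }.

Section IntegerDynamics.
Local Open Scope Z_scope.

Definition step_scale : Z := 4010000 * 101000.

(** 401 * 10000 times M (h - e), from
    401 * 10000 M = 4010 I + 8947 d1 d1^T: here 401 = |d1|^2, 4010 / (401 * 10000)
    = eps and 8947 / 10000 = mu - eps. *)
Definition scaled_x (e1 e2 h1 h2 : Z) : Z * Z :=
  let a1 := h1 - e1 in
  let a2 := h2 - e2 in
  let s := 8947 * (20 * a2 - a1) in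
  (4010 * a1 - s, 4010 * a2 + 20 * s).

(** Likewise 101 * 1000 N = 101 I + 998 d2 d2^T.  The arguments x1, x2 come from
    [scaled_x] over 4010000 den, so h is brought to that denominator first. *)
Definition scaled_y (h1 h2 x1 x2 : Z) : Z * Z :=
  let c1 := 4010000 * h1 - x1 in
  let c2 := 4010000 * h2 - x2 in
  let t := 998 * (10 * c2 - c1) in
  (101 * c1 - t, 101 * c2 + 10 * t).

(** With h = 1 - |q|, the step in deviations is
    xi = M (h - eta), eta' = N (h - xi) and
    q' = z_star + min q 0 - xi - eta', where z_star = (0, 1). *)
Definition scaled_step (s : scaled_state) : scaled_state :=
  let: ScaledState w e1 e2 q1 q2 := s in
  let n1 := Z.min q1 0 in
  let n2 := Z.min q2 0 in
  let h1 := w - Z.max q1 0 + n1 in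
  let h2 := w - Z.max q2 0 + n2 in
  let: (x1, x2) := scaled_x e1 e2 h1 h2 in
  let: (y1, y2) := scaled_y h1 h2 x1 x2 in
  ScaledState (step_scale * w) y1 y2
    (step_scale * n1 - 101000 * x1 - y1)
    (step_scale * (w + n2) - 101000 * x2 - y2).

Definition rescale (c : Z) (s : scaled_state) : scaled_state :=
  let: ScaledState w e1 e2 q1 q2 := s in
  ScaledState (c * w) (c * e1) (c * e2) (c * q1) (c * q2).

Definition scaled_eqb (s t : scaled_state) : bool :=
  [&& den s =? den t, eta1 s =? eta1 t, eta2 s =? eta2 t, q1 s =? q1 t & q2 s =? q2 t].

(** A single strict inequality for both the sign of q / w and the margin 1/1000. *)
Definition clear_sign (b : bool) (w q : Z) : bool :=
  w <? 1000 * (if b then q else - q).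

Definition clear_symbol (b : bool * bool) (s : scaled_state) : bool :=
  [&& 0 <? den s, clear_sign b.1 (den s) (q1 s) & clear_sign b.2 (den s) (q2 s)].

Fixpoint itinerary (bs : seq (bool * bool)) (s t : scaled_state) : bool :=
  if bs is b :: bs' then clear_symbol b s && itinerary bs' (scaled_step s) t
  else scaled_eqb s t.

(** Digits in base 2^256, the most significant one first. *)
Definition from_limbs (ds : seq Z) : Z := foldl (fun a d => 2 ^ 256 * a + d) 0 ds.

(** The fixed point of the return map of the word: the solution s of the
    4-dimensional linear system (I - A) s = b, where s |-> A s + b is the
    composition of the 66 affine steps, over the least common denominator. *)
Definition start_den : Z := from_limbs
     [:: 0xb45652e5b8177246936970fe297d8c96d30e8a705d2286;
      0xc9bfcfd7b4e492253c8574ffd1cbab1b93b5c6137a520064a4727166c9cb2891;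
      0x96fad0e267bc6d6ba964e8a9362cad04b61ae0d9091b40c25ab280afa4e81e21;
      0x1da9a0a232bc78bc8c1841640ed4c535ae3338c8ca5457edb2c4ddadff683407;
      0xa2b314c4a73556947d4a5bc6bd7635892d40038181047a0ad5d714fe483c5472;
      0x5d5911cdd5be3be75a247a849a0dc581cf547142fda4af837c54250110065c3c;
      0x808c51aae320147be59f780261f8849edf0cd3126c0c47bafff583ee6d44083d;
      0x4efece8076494aa9e42b7c02240dc78156c2de324f47a7be6e6d2e76a0aa51e1;
      0x660692130f3547b25bc389637a5a0d497815f5cfa519e1260d915f6a9fd43ec3;
      0x39a400e678abfba2d380ecd2d6b086534e19dcfe2ab0dda2d0134a61bb384c33;
      0x37061ef809a550cb2b09ed60bb85209b03b58a8e26a2b1ad19c864d6d29f7df0;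
      0xa33735ae7c45806673e2c53c11608d8754565934a7e23db45e9ea9c852deaaf1;
      0x54d0a33db657b3367da62cea9f4480fed956d85b662ca4c2b920b87be643c30f;
      0x47fb9a37c58cbc7592c1cd750e3f96997c4058fc64dcf1a68b6ce2088bede20c;
      0xe78f576c2aa04606000000000000000000000000000000000000000000000000].

Definition start_eta1 : Z := - from_limbs
     [:: 0xe0d512ed7fd04da66f39afb0bcd9916084364f0091157;
      0x54a8ea3c23afbb3e65967412819d800f38a1cec0389ecbfbe9193e1308ddee72;
      0x3ea86e7be7f75ff2ce7bb72a83f22e07877c59c66611117a8d16ece389086491;
      0x2ce8cd7092844375fe84a545ccecb50fe16d61995b907c0cf355eb94ad251860;
      0x6f27d967b490d9d9655443fb595e13ffaeb9adae1fa5e6657289dadfe8539748;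
      0x55273688202315ed6cefde3ffc876fdb5f3a388b5a7ed3eda665f62255a64f48;
      0xeb6279943fb3874adb1c937a5c13ceb722154ec163715c635c00ce18240f2437;
      0x42e42980b734df217636e99ffe0e99f5d77b3f881c00faf19692bd7a38f40227;
      0xbf8bb9423126ca002525189c0767769a1923fa16fbf1e71256272e20d46bc241;
      0x4a8ca55c176dc3045d50d2d3d693e5e9d26ed7dafdb778cc4091c0502d35b93b;
      0x151b8351873670f66de61b0dffbe268ae0271b01f7507063727060954ffdc6f0;
      0x9f89b0a72fe3934ac7d49716b79cff3d70383a84b4b8596396d093b0b6b56f6c;
      0xbbf14b8885d6e514ea08713adf8ff8d5e5dc4f8bf076bfdc995d34abe21b5e3b;
      0x691e98154ec8f408170387d2ef723d9764cb267f1e3a0b0bad83e0ffe2475b67;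
      0xcf35d41b3823cfce387918e93749ed94b12e1a0ca2bee2448668955db691c360].

Definition start_eta2 : Z := from_limbs
     [:: 0x8c3e5ee87b5981fbbbb135d29601f410b59a93a9fdbd12;
      0x283fe038acfa785572e6ea6258961d02471142659d1e8740112d7e28a6a364c4;
      0x6af18c6dfdadb965123df0724f93321c5b4c6173415f08c4b47a6e44cd419d36;
      0x2ebedb647072221c80a9ce0fa09e5e34d06d86b36f31c1652d32b8814d6f4603;
      0x277fcb189a98333f8ec8b74e0c34fe014cea069f6d8127211fef5330f1bc5674;
      0x1dd7de0f7a9e4dbbdc2687a22e18008c02ab6e7db1593e9b3cf6d00378e8b1fa;
      0x6ea721090f2b46e1e2dba7d55ae656fd14e947e64e374ede2fcbf9806f69b07b;
      0x7bbfaa8d737b12c5f5e141d5526a1b8fe3febbe85e4850e62c9605ab4cd737c1;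
      0xdf0bafec735ebf37da610c721c1605a4ef3f979124851d7172b4a594288dbff7;
      0x773c229c43eb0e674a5b19c0ec338486bb844ab95d3390cde13a0d92b29fbca3;
      0x897a544d4d47de8bf0e81aab9ddede54b821926eeee90cb914f039a7e2b25741;
      0x29f480eab4e7c17f69215486639b5c97caf9fb50d5a8df51554b0a6763a96a19;
      0x7cfc5039881fdf981066b64df39793e69f2da637d37442103eb9c0c2b0f30ba6;
      0x404e8c16e0570320b9dfe0bd91a5fb3fea63933dd86b5d41777fad92932c5741;
      0x9533c92ec5c0c2eed393a57315f0ba3c446ff6d9c26907937a1aa847fd467cbd].

Definition start_q1 : Z := - from_limbs
     [:: 0xcfb4db17a018ec99b37bee5ba13de39495e8ff7871cff8;
      0xd79c7cbd5d2e154fb98241f1df0a1266478e0d2334ecb6e553440d43ffd63b6a;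
      0xec09fd17f675c3ec462091902fb15700ed9f82cadb5a06534863057595c6f3fe;
      0x66930b578fb6fb49ef20eb93f67323362e0aefa02c15019ac1919fcb8fad1acc;
      0x91aeeab6d07b1c24c6fcd6bf4b705f1c509498529276a84d1c5d5da53153fb9d;
      0x7de6933ab31f2312549efebd7d522824773df1cc0c2dfdf30631d5e88b2ccfdc;
      0xba381c0b5811faee32afc6c974e8020228cc38b7e5d674a595018085ae86dc0e;
      0xbf9d989cf7b14eac2ebb873b07b4b594f9028ff56b7e5f2316ed7c375f65d3fa;
      0xfaf279260fcd189aa6dd3cdcdc1a0271d9445b24ae0f489abd987bdef32e2ac7;
      0x965f75e88d49b8dac87c17fb7e1f78c8d410542207288f2a25326b8df00a423b;
      0xc91571651bea7235f66e015eefcee5d89230a026d30117cc20fd24fec3617f7b;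
      0x43254bfa6df11e4d066f3be73ac04b2208018c5d90397871ed2999f13b301a41;
      0x57b8126c1b1731c8cb3a6494af4287cb785dc0cc3af7a9f55904682b66154a7c;
      0x6a1f1df4bf9f93fd1a0aadde67e466a7985239337a66f9460d285010fae338d0;
      0xcbf8d6cfecf51a5c2e2520133e756171221eb6df395672a8f8796dff4135da00].

Definition start_q2 : Z := - from_limbs
     [:: 0x18dea4b994358440315bad7f80d6735e8431cc0239970;
      0xf9c7ca1486fcb68ba7f948ffa9ac0568cf2ce10cc56a22abddc21087792bfab4;
      0x52b1824058055f69a040f2311aaf018bf791b8ebd20ddcdcee9f7f592346b5bf;
      0x14d339857bcbc9079ea580f5758e86e016df9244e96a38df698f115ac6c4b962;
      0x6d65742785bec776100e939d514a24ec4c9b4ae88ccc34baa97fcfc14e34c434;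
      0x13752b2e2828bfdedb34fba921d88be567f956676503bdc83b7c7c3fe65493f8;
      0xfd652a688031cf00fb77d191468f9f1907d681eca90f8d53cbcdca87dfc32616;
      0x17aaee9358b0544b5e96a28b12ecc111defd4df56c695c54fab299077cc495f8;
      0x09692a2954a9e26887af07ec9c093b91715e163550a59a3e4bad0ac45c479e00;
      0x7df66cb367b10e9641f3a959ddd2cad68e69c9d8f7c2e22d523be435a8f2ffc3;
      0x2d5c09c8315226df0dc335fc379bf9eb76c359b0b5dcfd3c5c3599d33b4d9c7d;
      0xf5b4cb487da701732df5c73b385df9fbd87448d7d9c8ffe8ac15169f2d1c6f39;
      0xad9ff83fb5ff8b057f74c5d7a964024ff87cfc1ae4c12a4936a296c697538169;
      0x480a2d7d28e56462c0bd84f36af2142e3168dfd32fc3d31a64925794613a68f7;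
      0xb8481038ce78f249a5037c5ea27c4704145d31cd3e4658476447f02093abad3b].

Definition start : scaled_state :=
  ScaledState start_den start_eta1 start_eta2 start_q1 start_q2.

(** Evaluation of the 66 steps.  The orbit closes up to the factor by which the
    common denominator has grown. *)
Lemma start_itinerary : itinerary word start (rescale (step_scale ^ 66) start).
Proof. by vm_compute. Qed.

End IntegerDynamics.

Lemma scaled_eqbP s t : scaled_eqb s t -> s = t.
Proof.
case: s t => [w e1 e2 p1 p2] [w' e1' e2' p1' p2'] /and5P[/=].
by move=> /Z.eqb_eq-> /Z.eqb_eq-> /Z.eqb_eq-> /Z.eqb_eq-> /Z.eqb_eq->.
Qed.

Lemma itineraryP bs s t : itinerary bs s t ->
  (forall k, (k < size bs)%N ->
     clear_symbol (nth (false, false) bs k) (iter k scaled_step s)) /\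
  iter (size bs) scaled_step s = t.
Proof.
elim: bs s => [|b bs IHbs] s /=; first by move=> /scaled_eqbP.
move=> /andP[sb /IHbs[signs last]]; split; last by rewrite -iterS iterSr.
by move=> [//|k] k_lt; rewrite iterSr /=; exact: signs.
Qed.

(** * Integer states as rational iterates *)

Definition ratZ (a : Z) : rat := (int_of_Z a)%:~R.

Lemma ratZ_lt a b : (ratZ a < ratZ b) = Z.ltb a b.
Proof. by rewrite /ratZ ltr_int; apply/idP/idP; lia. Qed.

Lemma ratZ_le a b : (ratZ a <= ratZ b) = Z.leb a b.
Proof. by rewrite /ratZ ler_int; apply/idP/idP; lia. Qed.

Lemma ratZ0 : ratZ Z0 = 0. Proof. by []. Qed.

Lemma ratZ_gt0 a : (0 < ratZ a) = Z.ltb Z0 a.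
Proof. by rewrite -ratZ0 ratZ_lt. Qed.

Lemma ratZM a b : ratZ (Z.mul a b) = ratZ a * ratZ b.
Proof. by rewrite /ratZ; ring. Qed.

Lemma ratZ_max0 a : ratZ (Z.max a Z0) = Num.max (ratZ a) 0.
Proof.
rewrite -ratZ0; case: (Z.max_spec a Z0) => -[az ->].
  by rewrite max_r // ratZ_le; lia.
by rewrite max_l // ratZ_le; lia.
Qed.

Lemma ratZ_min0 a : ratZ (Z.min a Z0) = Num.min (ratZ a) 0.
Proof.
rewrite -ratZ0; case: (Z.min_spec a Z0) => -[az ->].
  by rewrite min_l // ratZ_le; lia.
by rewrite min_r // ratZ_le; lia.
Qed.

Local Notation yzl := ('cV[rat]_2 * 'cV[rat]_2 * 'cV[rat]_2)%type.

(** The step acts on triples (y, z, lambda), because it does not read the old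
    x. *)
Definition x_update (v : yzl) : 'cV[rat]_2 :=
  let: (y, z, l) := v in M *m (bbar - y - z + l).

Definition rat_step (v : yzl) : yzl :=
  let: (y, z, l) := v in
  let x' := x_update v in
  let y' := N *m (bbar - x' - z + l) in
  let z' := map_mx (fun t => Num.max t 0) (bbar - x' - y' + l) in
  (y', z', l - (x' + y' + z' - bbar)).

(** The positive part of z + lambda is z and the negative part is lambda, so the
    projection input determines both. *)
Definition yzl_of (s : scaled_state) : yzl :=
  let: ScaledState w e1 e2 q1 q2 := s in
  (y_star + vec2 (ratZ e1 / ratZ w) (ratZ e2 / ratZ w),
   vec2 (ratZ (Z.max q1 Z0) / ratZ w) (ratZ (Z.max q2 Z0) / ratZ w),
   vec2 (ratZ (Z.min q1 Z0) / ratZ w) (ratZ (Z.min q2 Z0) / ratZ w)).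

Lemma colP2 (F : Type) (u v : 'cV[F]_2) : u 0 0 = v 0 0 -> u 1 0 = v 1 0 -> u = v.
Proof.
move=> uv0 uv1; apply/matrixP => i j; rewrite (ord1 j).
by case: i => [[|[|//]]] ?; [move: uv0|move: uv1]; congr (_ = _);
  congr (fun_of_matrix _ _ _); apply: val_inj.
Qed.

Lemma vec2_0 (F : Type) (a b : F) : vec2 a b 0 0 = a.
Proof. by rewrite mxE. Qed.

Lemma vec2_1 (F : Type) (a b : F) : vec2 a b 1 0 = b.
Proof. by rewrite mxE. Qed.

Lemma vec2D (V : nmodType) (a b c d : V) : vec2 a b + vec2 c d = vec2 (a + c) (b + d).
Proof. by apply: colP2; rewrite !mxE. Qed.

Lemma vec2Z (F : pzRingType) (k a b : F) : k *: vec2 a b = vec2 (k * a) (k * b).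
Proof. by apply: colP2; rewrite !mxE. Qed.

Lemma vec2_dot (F : pzRingType) (a b c d : F) :
  ((vec2 a b)^T *m vec2 c d) 0 0 = a * c + b * d.
Proof. by rewrite mxE !big_ord_recl big_ord0 /= !mxE /= addr0. Qed.

Lemma two_scale_vec2 (F : fieldType) (p q e m a b : F) :
  let t := (m - e) * (p * p + q * q)^-1 * (p * a + q * b) in
  two_scale (vec2 p q) e m *m vec2 a b = vec2 (e * a + t * p) (e * b + t * q).
Proof. by rewrite two_scale_mulmx !vec2_dot !vec2Z vec2D. Qed.

Lemma M_vec2 (a b : rat) : M *m vec2 a b = vec2
  ((401 * 10000)^-1 * (4010 * a - 8947 * (20 * b - a)))
  ((401 * 10000)^-1 * (4010 * b + 20 * (8947 * (20 * b - a)))).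
Proof. by rewrite ME two_scale_vec2; apply: (congr2 vec2); rewrite /mu /eps; field. Qed.

Lemma N_vec2 (a b : rat) : N *m vec2 a b = vec2
  ((101 * 1000)^-1 * (101 * a - 998 * (10 * b - a)))
  ((101 * 1000)^-1 * (101 * b + 10 * (998 * (10 * b - a)))).
Proof. by rewrite NE two_scale_vec2; apply: (congr2 vec2); rewrite /nu /eps; field. Qed.

Lemma mulmx_resolvent (A : 'M[rat]_2) (x : 'cV[rat]_2) : A \in unitmx ->
  A *m (x + (invmx A - 1%:M) *m x) = x.
Proof.
move=> uA.
by rewrite mulmxDr mulmxA mulmxBr mulmxV // mulmx1 mulmxBl mul1mx addrC subrK.
Qed.

(** The point x_star is the proximal point of x_star + lambda_star, since
    Q1 x_star = lambda_star; this is what cancels bbar from the x-update. *)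
Lemma M_star : M *m (x_star + lambda_star) = x_star.
Proof.
have -> : lambda_star = Q1 *m x_star by rewrite /x_star mulKVmx // Q1_unit.
by rewrite /Q1; exact: mulmx_resolvent M_unit.
Qed.

Lemma N_star : N *m (y_star + lambda_star) = y_star.
Proof.
have -> : lambda_star = Q2 *m y_star by rewrite /y_star mulKVmx // Q2_unit.
by rewrite /Q2; exact: mulmx_resolvent N_unit.
Qed.

Lemma max0_min0 (a : rat) : a - Num.max a 0 = Num.min a 0.
Proof. by case: (lerP 0 a) => _; rewrite ?subrr ?subr0. Qed.

(** With h = 1 - |q|, the new x and y as deviations from x_star and y_star. *)
Definition x_dev (e1 e2 h1 h2 : rat) : rat * rat :=
  let a1 := h1 - e1 in
  let a2 := h2 - e2 in
  let s := 8947 * (20 * a2 - a1) in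
  ((401 * 10000)^-1 * (4010 * a1 - s), (401 * 10000)^-1 * (4010 * a2 + 20 * s)).

Definition y_dev (h1 h2 x1 x2 : rat) : rat * rat :=
  let c1 := h1 - x1 in
  let c2 := h2 - x2 in
  let t := 998 * (10 * c2 - c1) in
  ((101 * 1000)^-1 * (101 * c1 - t), (101 * 1000)^-1 * (101 * c2 + 10 * t)).

(** Here bbar - y_star = x_star + z_star, and z_star = lambda_star + (1, 1): the
    shift (1, 1) is the 1 in h = 1 - p + n = 1 - |q|. *)
Lemma x_update_dev e1 e2 p1 p2 n1 n2 :
  let x := x_dev e1 e2 (1 - p1 + n1) (1 - p2 + n2) in
  x_update (y_star + vec2 e1 e2, vec2 p1 p2, vec2 n1 n2) = x_star + vec2 x.1 x.2.
Proof.
rewrite /x_update.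
have -> : bbar - (y_star + vec2 e1 e2) - vec2 p1 p2 + vec2 n1 n2 =
    x_star + lambda_star + vec2 (1 - p1 + n1 - e1) (1 - p2 + n2 - e2).
  rewrite /bbar /z_star /lambda_star; move: x_star y_star => xs ys.
  by apply: colP2; rewrite !(vec2_0, vec2_1, mxE); ring.
by rewrite mulmxDr M_star M_vec2.
Qed.

Lemma y_update_dev x1 x2 p1 p2 n1 n2 :
  let y := y_dev (1 - p1 + n1) (1 - p2 + n2) x1 x2 in
  N *m (bbar - (x_star + vec2 x1 x2) - vec2 p1 p2 + vec2 n1 n2) =
  y_star + vec2 y.1 y.2.
Proof.
have -> : bbar - (x_star + vec2 x1 x2) - vec2 p1 p2 + vec2 n1 n2 =
    y_star + lambda_star + vec2 (1 - p1 + n1 - x1) (1 - p2 + n2 - x2).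
  rewrite /bbar /z_star /lambda_star; move: x_star y_star => xs ys.
  by apply: colP2; rewrite !(vec2_0, vec2_1, mxE); ring.
by rewrite mulmxDr N_star N_vec2.
Qed.

Lemma rat_stepP y z l x' y' z' l' : x_update (y, z, l) = x' ->
  N *m (bbar - x' - z + l) = y' ->
  map_mx (fun t => Num.max t 0) (bbar - x' - y' + l) = z' ->
  bbar - x' - y' + l - z' = l' ->
  rat_step (y, z, l) = (y', z', l').
Proof.
move=> x'E y'E z'E <-; rewrite /rat_step x'E y'E z'E; congr (_, _, _).
by move: bbar => b; apply/matrixP => i j; rewrite !mxE; ring.
Qed.

Lemma proj_input_dev (xs ys : 'cV[rat]_2) x1 x2 y1 y2 n1 n2 :
  xs + ys + vec2 0 1 - (xs + vec2 x1 x2) - (ys + vec2 y1 y2) + vec2 n1 n2 =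
  vec2 (n1 - x1 - y1) (1 + n2 - x2 - y2).
Proof. by apply: colP2; rewrite !(vec2_0, vec2_1, mxE); ring. Qed.

Lemma rat_step_dev e1 e2 p1 p2 n1 n2 x1 x2 y1 y2 r1 r2 :
  (x1, x2) = x_dev e1 e2 (1 - p1 + n1) (1 - p2 + n2) ->
  (y1, y2) = y_dev (1 - p1 + n1) (1 - p2 + n2) x1 x2 ->
  r1 = n1 - x1 - y1 -> r2 = 1 + n2 - x2 - y2 ->
  rat_step (y_star + vec2 e1 e2, vec2 p1 p2, vec2 n1 n2) =
  (y_star + vec2 y1 y2, vec2 (Num.max r1 0) (Num.max r2 0),
   vec2 (Num.min r1 0) (Num.min r2 0)).
Proof.
move=> xE yE r1E r2E.
have qE : bbar - (x_star + vec2 x1 x2) - (y_star + vec2 y1 y2) + vec2 n1 n2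
    = vec2 r1 r2 by rewrite r1E r2E; exact: proj_input_dev.
apply: (rat_stepP _ _ _ (x_star + vec2 x1 x2)).
- by rewrite x_update_dev -xE.
- by rewrite y_update_dev -yE.
- by rewrite qE; apply: colP2; rewrite !(vec2_0, vec2_1, mxE).
- by rewrite qE; apply: colP2; rewrite !(vec2_0, vec2_1, mxE) max0_min0.
Qed.

Lemma max_div0 (a w : rat) : 0 < w -> Num.max (a / w) 0 = Num.max a 0 / w.
Proof. by move=> w0; rewrite maxr_pMl ?invr_ge0 ?ltW // mul0r. Qed.

Lemma min_div0 (a w : rat) : 0 < w -> Num.min (a / w) 0 = Num.min a 0 / w.
Proof. by move=> w0; rewrite minr_pMl ?invr_ge0 ?ltW // mul0r. Qed.

Section ClearDenominators.
Variable w : Z.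
Hypothesis w_gt0 : 0 < ratZ w.

Let rw_neq0 : ratZ w != 0. Proof. by rewrite gt_eqF. Qed.

Lemma step_scaleE : ratZ (Z.mul step_scale w) = 401 * 10000 * (101 * 1000) * ratZ w.
Proof. by rewrite /ratZ /step_scale; ring. Qed.

Lemma step_scale_gt0 : 0 < ratZ (Z.mul step_scale w).
Proof.
have s_gt0 : 0 < ratZ step_scale by rewrite ratZ_gt0.
by rewrite ratZM; exact: mulr_gt0 s_gt0 w_gt0.
Qed.

Lemma scaled_xP e1 e2 h1 h2 x1 x2 : scaled_x e1 e2 h1 h2 = (x1, x2) ->
  x_dev (ratZ e1 / ratZ w) (ratZ e2 / ratZ w) (ratZ h1 / ratZ w) (ratZ h2 / ratZ w) =
  (ratZ x1 / (401 * 10000 * ratZ w), ratZ x2 / (401 * 10000 * ratZ w)).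
Proof.
move=> xE; rewrite -[x1]/((x1, x2).1) -[x2]/((x1, x2).2) -xE.
move: rw_neq0; rewrite /scaled_x /x_dev /ratZ => w0.
by apply: (congr2 pair); rewrite /fst /snd; field.
Qed.

Lemma scaled_yP h1 h2 x1 x2 y1 y2 : scaled_y h1 h2 x1 x2 = (y1, y2) ->
  y_dev (ratZ h1 / ratZ w) (ratZ h2 / ratZ w)
    (ratZ x1 / (401 * 10000 * ratZ w)) (ratZ x2 / (401 * 10000 * ratZ w)) =
  (ratZ y1 / ratZ (Z.mul step_scale w), ratZ y2 / ratZ (Z.mul step_scale w)).
Proof.
move=> yE; rewrite -[y1]/((y1, y2).1) -[y2]/((y1, y2).2) -yE step_scaleE.
move: rw_neq0; rewrite /scaled_y /y_dev /ratZ => w0.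
by apply: (congr2 pair); rewrite /fst /snd; field.
Qed.

End ClearDenominators.

Lemma rat_step_yzl_of s : Z.ltb Z0 (den s) -> rat_step (yzl_of s) = yzl_of (scaled_step s).
Proof.
case: s => [w e1 e2 p1 p2]; rewrite [den _]/= -ratZ_gt0 => w0.
have rw_neq0 : ratZ w != 0 by rewrite gt_eqF.
have hE m n : 1 - ratZ m / ratZ w + ratZ n / ratZ w =
    ratZ (Z.add (Z.sub w m) n) / ratZ w.
  by rewrite /ratZ in rw_neq0 *; field.
rewrite /yzl_of /scaled_step.
move: (Z.min p1 Z0) (Z.min p2 Z0) (Z.max p1 Z0) (Z.max p2 Z0) => n1 n2 m1 m2.
case xZ: (scaled_x _ _ _ _) => [x1 x2]; have xE := scaled_xP w w0 _ _ _ _ _ _ xZ.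
case yZ: (scaled_y _ _ _ _) => [y1 y2]; have yE := scaled_yP w w0 _ _ _ _ _ _ yZ.
rewrite !ratZ_max0 !ratZ_min0 -!(max_div0 _ _ (step_scale_gt0 w w0)).
rewrite -!(min_div0 _ _ (step_scale_gt0 w w0)).
apply: (rat_step_dev _ _ _ _ _ _ (ratZ x1 / (401 * 10000 * ratZ w))
  (ratZ x2 / (401 * 10000 * ratZ w))).
- by rewrite (hE m1 n1) (hE m2 n2); exact: esym xE.
- by rewrite (hE m1 n1) (hE m2 n2); exact: esym yE.
- by rewrite step_scaleE; rewrite /ratZ /step_scale in rw_neq0 *; field.
- by rewrite step_scaleE; rewrite /ratZ /step_scale in rw_neq0 *; field.
Qed.

(** * Periodic sequences *)

Section PeriodicSequence.
Context {T : Type} (u : nat -> T) (p : nat).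
Hypothesis u_periodic : forall k, u (k + p)%N = u k.

Lemma periodic_mul k n : u (k + n * p)%N = u k.
Proof. by elim: n => [|n IHn]; rewrite ?addn0 // mulSn addnCA addnC u_periodic. Qed.

Lemma periodic_mod k : u k = u (k %% p)%N.
Proof. by rewrite {1}(divn_eq k p) addnC periodic_mul. Qed.

End PeriodicSequence.

Lemma periodic_bounded (R : realType) (V : normedModType R) (u : nat -> V) p :
  (0 < p)%N -> (forall k, u (k + p)%N = u k) -> bounded_fun u.
Proof.
move=> p0 up; exists (\sum_(i < p) `|u i|); split; first exact: num_real.
move=> B ltB k _ /=; rewrite (periodic_mod _ _ up) (le_trans _ (ltW ltB)) //.
have km : (k %% p < p)%N by rewrite ltn_mod.
by rewrite (bigD1 (Ordinal km)) //= lerDl sumr_ge0.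
Qed.

(** The subsequence k, k + p, k + 2 p, ... is constant, and it has the limit of
    the whole sequence. *)
Lemma periodic_cvg (R : realType) (V : normedModType R) (u : nat -> V) p w :
  (0 < p)%N -> (forall k, u (k + p)%N = u k) -> u @ \oo --> w -> forall k, u k = w.
Proof.
move=> p0 up uw k; apply: (@cvg_unique V (@norm_hausdorff R V) (u k @[_ --> \oo])).
  exact: cvg_cst.
have -> : (fun _ : nat => u k) = u \o (fun n => k + n * p)%N.
  by apply/funext => n /=; rewrite periodic_mul.
apply: cvg_comp uw; apply/cvgnyPge => A; near=> n.
have : (A <= n)%N by near: n; exact: nbhs_infty_ge.
by move=> An; rewrite (leq_trans An) // (leq_trans _ (leq_addl _ _)) // leq_pmulr.
Unshelve. all: by end_near. Qed.

(** * The periodic orbit of the method *)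

Section RealOrbit.
Variable R : realType.

Definition embed (x : 'cV[rat]_2) (v : yzl) : primal_dual R 2 2 2 2 :=
  let: (y, z, l) := v in (to_real R x, to_real R y, to_real R z, to_real R l).

Lemma to_real_mulmx (A : 'M[rat]_2) (b y z l : 'cV[rat]_2) :
  to_real R (A *m (b - y - z + l)) =
  to_real R A *m (to_real R b - to_real R y - to_real R z + to_real R l).
Proof. by rewrite /to_real map_mxM map_mxD !map_mxB. Qed.

Lemma ratr_max0 (a : rat) : ratr (Num.max a 0) = Num.max (ratr a) 0 :> R.
Proof.
case: (lerP 0 a) => a0; first by rewrite max_l // ler0q.
by rewrite rmorph0 max_r // ltW // ltrq0.
Qed.

Lemma to_real_pos_part (b x y l : 'cV[rat]_2) :
  to_real R (map_mx (fun t => Num.max t 0) (b - x - y + l)) =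
  pos_part (to_real R b - to_real R x - to_real R y + to_real R l).
Proof. by apply/matrixP => i j; rewrite !mxE ratr_max0 !(rmorphD, rmorphN). Qed.

Lemma to_real_multiplier (b x y z l : 'cV[rat]_2) :
  to_real R (l - (x + y + z - b)) =
  to_real R l - (to_real R x + to_real R y + to_real R z - to_real R b).
Proof. by rewrite /to_real !(map_mxD, map_mxN). Qed.

Lemma embed_step x v : qp_admm_step (embed x v) = embed (x_update v) (rat_step v).
Proof.
case: v => [[y z] l]; apply: qp_admm_stepP (erefl _) _ _ _ _.
- exact: to_real_mulmx.
- exact: to_real_mulmx.
- exact: to_real_pos_part.
- exact: to_real_multiplier.
Qed.

(** The step forgets x, so a periodic orbit of (y, z, lambda) closes up in x as
    soon as x is started at the value that the previous turn ends with. *)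
Lemma embed_orbit v p : iter p.+1 rat_step v = v -> forall k,
  qp_admm (embed (x_update (iter p rat_step v)) v) k =
  embed (x_update (iter (k + p) rat_step v)) (iter k rat_step v).
Proof.
move=> vp; elim=> [//|k IHk]; rewrite /qp_admm iterS -/(qp_admm _ k) IHk embed_step.
by rewrite -iterS addSnnS iterD vp.
Qed.

Lemma ratio_gt (F : realFieldType) (a w : F) :
  0 < w -> w < 1000 * a -> 1 / 1000 < a / w.
Proof. by move=> w0 wa; rewrite ltr_pdivlMr //; lra. Qed.

Lemma ratr_invn n : ratr (1 / n%:R) = 1 / n%:R :> R.
Proof. by rewrite fmorph_div rmorph1 rmorph_nat. Qed.

Lemma strict_sign_ratr b (c t : rat) : 0 < c -> c < (if b then t else - t) ->
  strict_sign b (ratr t : R) /\ ratr c < `|ratr t : R|.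
Proof.
move=> c0; case: b => ct.
  have t0 : 0 < ratr t :> R by rewrite ltr0q (lt_trans c0).
  by split; rewrite // gtr0_norm // ltr_rat.
have t0 : ratr t < 0 :> R by rewrite ltrq0 -oppr_gt0 (lt_trans c0).
by split; rewrite // ltr0_norm // -rmorphN ltr_rat.
Qed.

Lemma clear_sign_ratr b w q : Z.ltb Z0 w -> clear_sign b w q ->
  strict_sign b (ratr (ratZ q / ratZ w) : R) /\
  1 / 1000 < `|ratr (ratZ q / ratZ w) : R|.
Proof.
have c_gt0 : 0 < 1 / 1000 :> rat by lra.
rewrite -ratZ_gt0 /clear_sign -ratZ_lt => w0 wq.
have scaleE : ratZ (Z.mul 1000 (if b then q else Z.opp q)) =
    1000 * (if b then ratZ q else - ratZ q) by case: (b); rewrite /ratZ; ring.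
have {}wq : 1 / 1000 < (if b then ratZ q / ratZ w else - (ratZ q / ratZ w)).
  by move: wq; rewrite scaleE; case: (b) => /(ratio_gt _ _ _ w0); rewrite ?mulNr.
have -> : (1 / 1000 : R) = ratr (1 / 1000) by rewrite (ratr_invn 1000).
exact: strict_sign_ratr c_gt0 wq.
Qed.

Lemma to_real_vec2 (a b : rat) : to_real R (vec2 a b) = vec2 (ratr a) (ratr b).
Proof. by apply: colP2; rewrite !mxE. Qed.

Lemma proj_input_yzl_of x s :
  proj_input (embed x (yzl_of s)) =
  vec2 (ratr (ratZ (q1 s) / ratZ (den s))) (ratr (ratZ (q2 s) / ratZ (den s))).
Proof.
have maxmin (a w : rat) : ratr (Num.max a 0 / w) + ratr (Num.min a 0 / w) = ratr (a / w) :> R.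
  by rewrite -rmorphD -mulrDl -max0_min0 addrC subrK.
case: s => [w e1 e2 p1 p2]; rewrite /yzl_of /embed /proj_input.
by rewrite !ratZ_max0 !ratZ_min0 !to_real_vec2 vec2D !maxmin.
Qed.

Lemma clear_symbol_embed b x s : clear_symbol b s ->
  has_sign_symbol b (proj_input (embed x (yzl_of s))) /\
  forall i : 'I_2, 1 / 1000 < `|proj_input (embed x (yzl_of s)) i 0|.
Proof.
move=> /and3P[w0 /(clear_sign_ratr _ _ _ w0)[s1 m1] /(clear_sign_ratr _ _ _ w0)[s2 m2]].
rewrite proj_input_yzl_of /has_sign_symbol vec2_0 vec2_1; split=> // i.
rewrite mxE; by case: ifP.
Qed.

End RealOrbit.

Lemma yzl_of_rescale c s : Z.ltb Z0 c -> yzl_of (rescale c s) = yzl_of s.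
Proof.
rewrite -ratZ_gt0 => c0; case: s => [w e1 e2 p1 p2].
have cK a : ratZ (Z.mul c a) / ratZ (Z.mul c w) = ratZ a / ratZ w.
  by rewrite !ratZM -mulf_div mulfV ?mul1r // gt_eqF.
have maxM a : Z.max (Z.mul c a) Z0 = Z.mul c (Z.max a Z0).
  by move: c0; rewrite ratZ_gt0; lia.
have minM a : Z.min (Z.mul c a) Z0 = Z.mul c (Z.min a Z0).
  by move: c0; rewrite ratZ_gt0; lia.
by rewrite /rescale /yzl_of !maxM !minM !cK.
Qed.

(** A certified itinerary follows the rational step: positivity of the common
    denominator, which it records, is all that the comparison asks for. *)
Lemma itinerary_rat_step bs s t : itinerary bs s t -> forall k, (k <= size bs)%N ->
  iter k rat_step (yzl_of s) = yzl_of (iter k scaled_step s).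
Proof.
move=> /itineraryP[clear _]; elim=> [//|k IHk] k_lt; rewrite !iterS IHk ?(ltnW k_lt) //.
by apply: rat_step_yzl_of; have /and3P[] := clear k k_lt.
Qed.

Lemma itinerary_periodic bs s c : Z.ltb Z0 c -> itinerary bs s (rescale c s) ->
  iter (size bs) rat_step (yzl_of s) = yzl_of s.
Proof.
move=> c0 it; rewrite (itinerary_rat_step _ _ _ it) //.
by have [_ ->] := itineraryP _ _ _ it; exact: yzl_of_rescale.
Qed.

Definition rat_start : yzl := yzl_of start.

(** The value of x at the end of the first turn. *)
Definition x_start : 'cV[rat]_2 := x_update (iter 65 rat_step rat_start).

Lemma size_word : size word = 66%N. Proof. by []. Qed.

Lemma rat_start_periodic : iter 66 rat_step rat_start = rat_start.
Proof.
have c_gt0 : Z.ltb Z0 (Z.pow step_scale 66) by vm_compute.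
by rewrite -size_word; exact: itinerary_periodic c_gt0 start_itinerary.
Qed.

Lemma word_snd k : (k < 66)%N -> (nth (false, false) word k).2 = (2 <= k)%N.
Proof.
move=> k_lt; rewrite /word nth_cat size_nseq !nth_nseq.
case: ltnP => k2 //=; rewrite ifT //; lia.
Qed.

Section Counterexample.
Variable R : realType.

Definition orbit : nat -> primal_dual R 2 2 2 2 :=
  qp_admm (to_real R x_start, to_real R rat_start.1.1, to_real R rat_start.1.2,
           to_real R rat_start.2).

Lemma orbitE k :
  orbit k = embed R (x_update (iter (k + 65) rat_step rat_start)) (iter k rat_step rat_start).
Proof.
rewrite -(embed_orbit R _ 65 rat_start_periodic) /orbit /x_start.
by case: rat_start => [[y z] l].
Qed.

Lemma orbit_periodic k : orbit (k + 66)%N = orbit k.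
Proof. by rewrite !orbitE addnAC ![iter (_ + 66) _ _]iterD rat_start_periodic. Qed.

Lemma orbit_clear k : (k < 66)%N ->
  has_sign_symbol (nth (false, false) word k) (proj_input (orbit k)) /\
  forall i : 'I_2, 1 / 1000 < `|proj_input (orbit k) i 0|.
Proof.
rewrite -size_word => k_lt.
rewrite orbitE (itinerary_rat_step _ _ _ start_itinerary _ (ltnW k_lt)).
have [clear _] := itineraryP _ _ _ start_itinerary.
exact: clear_symbol_embed (clear k k_lt).
Qed.

Lemma orbit_sign k : (k < 66)%N -> (0 < proj_input (orbit k) 1 0) = (2 <= k)%N.
Proof.
move=> k_lt; have [[_]] := orbit_clear _ k_lt; rewrite word_snd //.
by case: (2 <= k)%N => /=[->//|q_lt0] _; apply/negbTE; rewrite -leNgt ltW.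
Qed.

Lemma orbit_0_neq_2 : orbit 0 <> orbit 2.
Proof. by move=> eq02; have := orbit_sign 0 isT; rewrite eq02 orbit_sign. Qed.

(** From a KKT point on, the orbit would be constant; going round whole periods,
    it would be constant from the start. *)
Lemma orbit_not_KKT k : ~ qp_KKT (orbit k).
Proof.
move=> /qp_KKT_fixed fixed_k; apply: orbit_0_neq_2.
have stay j : orbit (j + k)%N = orbit k.
  by elim: j => // j IHj; rewrite addSn {1}/orbit /qp_admm iterS -/(qp_admm _ _) -/orbit IHj.
have turn j : orbit j = orbit (j + k * 66)%N by rewrite (periodic_mul _ _ orbit_periodic).
by rewrite (turn 0%N) (turn 2%N) !mulnSr !addnA !stay.
Qed.

(** The second coordinate of q is negative exactly at times 0 and 1.  Shifting
    time 0 by j leaves only j = 1, and shifting time 1 by 1 reaches time 2. *)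
Lemma orbit_minimal_period : minimal_period 66 orbit.
Proof.
split=> //; first exact: orbit_periodic.
move=> j /andP[j_gt0 j_lt] shift.
have j2 : (2 <= j)%N = false by rewrite -orbit_sign // -(add0n j) shift orbit_sign.
have j1 : j = 1%N by lia.
have := orbit_sign 1%N isT; rewrite -[1%N]/(1 + 0)%N.
by have := shift 1%N; rewrite j1 => <-; rewrite orbit_sign.
Qed.

Lemma qp_not_convergent : ~ identity_block_ensures_global_convergence R.
Proof.
move=> conv.
have [||||||||w _ orbit_w] := conv 2%N 2%N 2%N (qp_problem R) _ _ _ _ _ _ _ 1 orbit ltr01.
- exact: quad_closed_proper_convex (Q1_posdef R).
- exact: quad_closed_proper_convex (Q2_posdef R).
- exact: indicator_closed_proper_convex.
- exact: mxrank1.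
- exact: mxrank1.
- by [].
- by eexists; exact: star_is_KKT.
- exact: qp_admm_sequence.
have orbit_cst := periodic_cvg _ _ _ 66 _ isT orbit_periodic orbit_w.
by apply: orbit_0_neq_2; rewrite !orbit_cst.
Qed.

End Counterexample.

Theorem theorem2p1 (R : realType) :
  (sym_posdef (to_real R Q1) /\ sym_posdef (to_real R Q2)) /\
  (exists x0 y0 z0 l0 : 'cV[rat]_2,
    let u := qp_admm (to_real R x0, to_real R y0, to_real R z0, to_real R l0) in
    let q := fun k => proj_input (u k) in
    direct_admm_sequence (qp_problem R) 1 u /\
    [/\ bounded_fun u,
        (forall k, ~ qp_KKT (u k)),
        minimal_period 66 u,
        (forall k, (k < 66)%N -> has_sign_symbol (nth (false, false) word k) (q k))
      & (forall k, (k < 66)%N -> forall i : 'I_2, 1 / 1000 < `|q k i 0|)]) /\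
  ~ identity_block_ensures_global_convergence R.
Proof.
split; first by split; [exact: Q1_posdef|exact: Q2_posdef].
split; last exact: qp_not_convergent.
exists x_start, rat_start.1.1, rat_start.1.2, rat_start.2; split.
  exact: qp_admm_sequence.
split.
- exact: periodic_bounded _ _ _ 66 isT (orbit_periodic R).
- exact: orbit_not_KKT.
- exact: orbit_minimal_period.
- by move=> k /(orbit_clear R)[].
- by move=> k /(orbit_clear R)[].
Qed.
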